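(* Let $n\ge 2$, let $\mathbf{p}=(p_1,\ldots,p_n)\in[0,1]^n$ be arbitrary, and let $p$ be a real number with $p>0$ and $\max_{i} p_i\le p\le 1$. Then there exists a random vector $\tilde{\mathbf{c}}=(\tilde c_1,\ldots,\tilde c_n)$ with values in $\{0,1\}^n$ such that $\mathbb{P}(\tilde c_i=1)=p_i$ for all $i\in\{1,\ldots,n\}$ and $\mathbb{P}(\tilde c_i=1,\tilde c_j=1)=\dfrac{p_ip_j}{p}$ for all $1\le i<j\le n$. *)

(* Defs.v *)
From HB Require Import structures.
From mathcomp Require Export all_boot all_order all_algebra.
From mathcomp Require Export all_classical all_reals all_analysis.

#[export] Set Implicit Arguments.
#[export] Unset Strict Implicit.
#[export] Unset Printing Implicit Defensive.

(* {0,1}^n is [n.-tuple bool], with the product sigma-algebra of the discrete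
   one on [bool], and [tnth x i] its i-th coordinate ([true] is the value 1). *)

(* Main.v *)
Require Import Defs.
From HB Require Import structures.
From mathcomp Require Import all_boot all_order all_algebra.
From mathcomp Require Import all_classical all_reals all_analysis.
Import Order.TTheory GRing.Theory Num.Theory.
Local Open Scope classical_set_scope.
Local Open Scope ring_scope.

(** Take independent Bernoulli variables [Z] with parameter [p] and [B_i] with
    parameter [p_i / p], for [i < n]; the latter is a legitimate parameter
    because [0 <= p_i <= p] and [0 < p]. Put [c_i = Z && B_i]. Then [c_i] is
    true with probability [p * (p_i / p) = p_i], and for [i != j] the
    variables [c_i] and [c_j] are both true with probability
    [p * (p_i / p) * (p_j / p) = p_i * p_j / p].

    The family [(Z, B_0, ..., B_(n-1))] is indexed by [option 'I_n], with [Z]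
    at [None]; its joint law gives the vector [f] the weight
    [\prod_k bernoulli_pmf (q k) (f k)]. Lemma [sum_prod_bernoulli_pmf]
    evaluates the probability that all coordinates in a given set are true,
    and [finite_law] turns a finite family of weighted points (here the vectors
    [c]) into a probability measure. The random vector of the theorem is the
    identity of [n.-tuple bool] under the resulting law. *)

(** A finite nonnegative combination of Dirac masses is a measure. *)
Lemma finite_dirac_combination d (T : measurableType d) (R : realType)
    (I : Type) (r : seq I) (w : I -> R) (x : I -> T) :
    (forall i, 0 <= w i) ->
  exists mu : {measure set T -> \bar R},
    forall A, mu A = (\sum_(i <- r) w i * (x i \in A)%:R)%:E.
Proof.
move=> w0; elim: r => [|i r [mu muE]].
  by exists mzero => A; rewrite big_nil.
exists (measure_add (mscale (NngNum (w0 i)) (dirac (x i))) mu) => A.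
by rewrite big_cons EFinD EFinM -diracE -muE; exact: measure_addE.
Qed.

(** The law putting mass [w i] at the point [x i]. The points need not be
    distinct, and the formula holds for every [A], measurable or not. *)
Lemma finite_law d (T : measurableType d) (R : realType) (I : finType)
    (w : I -> R) (x : I -> T) :
    (forall i, 0 <= w i) -> \sum_i w i = 1 ->
  exists P : probability T R,
    forall A, P A = (\sum_(i | x i \in A) w i)%:E.
Proof.
move=> w0 w1.
have [mu muE] := finite_dirac_combination (index_enum I) x w0.
have muE' A : mu A = (\sum_(i | x i \in A) w i)%:E.
  rewrite muE [in RHS]big_mkcond; congr EFin; apply: eq_bigr => i _.
  by case: (x i \in A); rewrite ?mulr1 ?mulr0.
have mu1 : mu setT = 1%E.
  by rewrite muE' (eq_bigl predT) ?w1// => i; rewrite in_setT.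
(* Unpacking [mu] exposes the mixins from which the probability is packed. *)
case: mu muE' mu1 {muE} => mu [m0 m1] /= muE mu1.
pose muP := Measure_isProbability.Axioms_ mu m0 m1 mu1.
pose P : probability T R := HB.pack_for (probability T R) mu m0 m1 muP.
by exists P.
Qed.

(** Under the product of Bernoulli laws with parameters [q], all the
    coordinates in [S] are true with probability [\prod_(k in S) q k]. As an
    identity it needs no bounds on [q]. *)
Lemma sum_prod_bernoulli_pmf (R : numDomainType) (K : finType) (q : K -> R)
    (S : {set K}) :
  \sum_(f : {ffun K -> bool} | [forall k in S, f k])
     \prod_k bernoulli_pmf (q k) (f k)
  = \prod_(k in S) q k.
Proof.
(* The constraint on [f] is moved into the factors, so that the sum of
   products becomes a product of sums over [bool]. *)
pose F k b := if (k \in S) && ~~ b then 0 else bernoulli_pmf (q k) b.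
transitivity (\sum_(f : {ffun K -> bool}) \prod_k F k (f k)).
  rewrite big_mkcond; apply: eq_bigr => f _; case: ifPn => [/forall_inP Sf|].
    by apply: eq_bigr => k _; rewrite /F; case: ifPn => // /andP[/Sf ->].
  rewrite negb_forall_in => /exists_inP[k kS nfk].
  by rewrite (bigD1 k)//= /F kS nfk mul0r.
rewrite -bigA_distr_bigA [RHS]big_mkcond; apply: eq_bigr => k _.
rewrite big_bool /F /bernoulli_pmf /= andbF andbT.
case: (k \in S) => /=; first by rewrite addr0.
by rewrite addrC subrK.
Qed.

(* The base point 0 of the iterated maximum is harmless: the entries of [pv]
   are nonnegative and the index set is nonempty. *)
Theorem lemma2p1 (R : realType) (n : nat) (hn : (2 <= n)%N)
    (pv : 'I_n -> R) (hpv : forall i : 'I_n, 0 <= pv i <= 1)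
    (p : R) (hp0 : 0 < p)
    (hpmax : \big[Num.max/0]_(i < n) pv i <= p) (hp1 : p <= 1) :
  exists (d : measure_display) (T : measurableType d) (P : probability T R)
    (c : {RV P >-> n.-tuple bool}),
    (forall i : 'I_n, P [set t : T | tnth (c t) i = true] = (pv i)%:E) /\
    (forall i j : 'I_n, (i < j)%N ->
       P [set t : T | tnth (c t) i = true /\ tnth (c t) j = true]
         = (pv i * pv j / p)%:E).
Proof.
have ple i : pv i <= p by apply: le_trans hpmax; exact: le_bigmax.
pose q (k : option 'I_n) := if k is Some i then pv i / p else p.
have q01 k : 0 <= q k <= 1.
  case: k => [i|] /=; last by rewrite ltW.
  have /andP[pi0 _] := hpv i.
  by rewrite divr_ge0 ?(ltW hp0)//= ler_pdivrMr// mul1r.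
pose w (f : {ffun option 'I_n -> bool}) := \prod_k bernoulli_pmf (q k) (f k).
have w0 f : 0 <= w f by apply: prodr_ge0 => k _; exact: bernoulli_pmf_ge0.
have sumw (S : {set option 'I_n}) :
    \sum_(f : {ffun option 'I_n -> bool} | [forall k in S, f k]) w f =
    \prod_(k in S) q k.
  exact: sum_prod_bernoulli_pmf.
have w1 : \sum_f w f = 1.
  have := sumw finset.set0; rewrite finset.big_set0 => <-; apply: eq_bigl => f.
  by apply/esym/forall_inP => k; rewrite inE.
pose x (f : {ffun option 'I_n -> bool}) : n.-tuple bool :=
  [tuple f None && f (Some i) | i < n].
have [P PE] := finite_law x w0 w1.
pose c : {RV P >-> n.-tuple bool} :=
  HB.pack_for {mfun (n.-tuple bool) >-> (n.-tuple bool)} (@id (n.-tuple bool))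
    (isMeasurableFun.Build _ _ _ _ (@id (n.-tuple bool)) (@measurable_id _ _ _)).
exists _, _, P, c; split=> [i|i j ij]; rewrite PE; congr EFin.
- transitivity (\prod_(k in [set None; Some i]%SET) q k).
    rewrite -sumw; apply: eq_bigl => f; apply/idP/forall_inP.
      rewrite inE /= tnth_mktuple => /andP[fN fi] k.
      by rewrite !inE => /orP[] /eqP ->.
    by move=> H; rewrite inE /= tnth_mktuple !H ?inE ?eqxx ?orbT.
  by rewrite big_setU1 ?inE//= big_set1 mulrC divfK ?gt_eqF.
- have neij : i != j by rewrite -val_eqE ltn_eqF.
  transitivity (\prod_(k in [set None; Some i; Some j]%SET) q k).
    rewrite -sumw; apply: eq_bigl => f; apply/idP/forall_inP.
      rewrite inE /= !tnth_mktuple => -[/andP[fN fi] /andP[_ fj]] k.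
      by rewrite !inE => /orP[/orP[]|] /eqP ->.
    by move=> H; rewrite inE /= !tnth_mktuple !H ?inE ?eqxx ?orbT.
  rewrite -finset.setUA big_setU1 ?inE//= big_setU1 ?inE//= big_set1 /=.
  by rewrite mulrA (mulrC p) divfK ?gt_eqF// mulrA.
Qed.
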